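(* There exist absolute constants $C>0$ and $c>0$ such that for every prime power $q$ and all sets $A,B\subset SL_2(\mathbb{F}_q)$ and $D\subset M_2(\mathbb{F}_q)$ with $|B|\ge Cq^2$ and $|D|\ge Cq^2$, the set $A(B+D)=\{a(b+d): a\in A,\ b\in B,\ d\in D\}$ satisfies \[|A(B+D)|\ \ge\ c\,\min\left\{q^4,\ \frac{|A||B|^2|D|}{q^5},\ \frac{|A||B|}{q}\right\}.\]
   Context: $\mathbb{F}_q$ is the finite field with $q$ elements, $M_2(\mathbb{F}_q)$ is the ring of $2\times 2$ matrices over $\mathbb{F}_q$, and $SL_2(\mathbb{F}_q)$ is the set of matrices in $M_2(\mathbb{F}_q)$ with determinant $1$. The set $A(B+D)$ is the image of $A\times B\times D$ under $f(x,y,z)=x(y+z)$. *)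

(* Defs.v *)
From mathcomp Require Import all_boot all_algebra.

Set Implicit Arguments.
Unset Strict Implicit.
Unset Printing Implicit Defensive.

Import GRing.Theory.
Local Open Scope ring_scope.

Definition SL2 (F : finFieldType) : {set 'M[F]_2} := [set M | \det M == 1].

Definition mul_add (F : finFieldType) (t : 'M[F]_2 * 'M[F]_2 * 'M[F]_2) :
  'M[F]_2 := let: (x, y, z) := t in x *m (y + z).

Definition mul_add_set (F : finFieldType) (A B D : {set 'M[F]_2}) :
  {set 'M[F]_2} := @mul_add F @: setX (setX A B) D.

(* Main.v *)
(** It suffices to bound |A(B + D)| from below by a multiple of min(q^4, |A||B|/q), so D
    may be replaced by a subset with exactly q^2 elements.  Put f(x) = #{(b, d) : b + d = x}.
    At most half of the sums b + d are singular, so by Cauchy-Schwarz it is enough to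
    bound the number of solutions of a(b + d) = a'(b' + d') with both sides invertible
    by O(|A|^2 |B|^2 + q^5 |A||B|).

    On each coset {det = t} of SL_2 with t <> 0 split f into its mean and a part of
    mean zero.  The means contribute the second moment of the distribution of
    det(b + d), the mean-zero parts at most O(q^2 |A|) times sum f^2, because left
    convolution with A has squared operator norm O(q^2 |A|) on mean-zero functions.
    Both sum f^2 and the second moment are computed by extending [b] from B to SL_2:
    a hyperplane meets SL_2 in q^2 + O(q) points, and |D| = q^2 is exactly the size for
    which the diagonal d = d' balances that error, so Weil's bound for Kloosterman
    sums is not needed.

    For the operator norm, take the right average over the upper unipotent group, then
    over the lower one.  A function that is a nontrivial eigenvector of a unipotent
    group has, under the torus, about q/2 translates that are pairwise orthogonal, so
    Bessel's inequality gains a factor q over the Hilbert-Schmidt norm.  What remains is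
    the composition of the two averages, which itself contracts mean-zero functions by
    q^(-1/2). *)
Require Import Defs.
From mathcomp Require Import all_boot all_order all_algebra reals.
From mathcomp Require Import fingroup action classfun character algC.
From mathcomp Require Import ring lra.

Set Implicit Arguments.
Unset Strict Implicit.
Unset Printing Implicit Defensive.

Import Order.TTheory GRing.Theory Num.Theory.
Local Open Scope ring_scope.

(** * Additive characters and Cauchy-Schwarz *)

(** The additive group is abelian, so it has more than one irreducible character and all are linear.
    For a nontrivial one, translating by a [y] whose value is not 1 rescales the total sum, which is
    therefore zero. *)
Lemma nontrivial_additive_character (F : finFieldType) :
  exists psi : F -> algC,
    [/\ forall x y, psi (x + y) = psi x * psi y,
        forall x, psi (- x) = (psi x)^*, psi 0 = 1 & \sum_x psi x = 0].
Proof.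
have abF : abelian [set: F] by apply/centsP => x _ y _; exact: addrC.
have N1 : (1 < Nirr [set: F])%N.
  rewrite NirrE; move: abF; rewrite card_classes_abelian => /eqP ->.
  by rewrite cardsT card_finNzRing_gt1.
pose i : Iirr [set: F] := Ordinal N1.
have lin_i : 'chi_i \is a linear_char by move/char_abelianP: abF.
have chiD x y : 'chi_i (x + y) = 'chi_i x * 'chi_i y.
  by rewrite -(lin_charM lin_i) ?inE.
exists (fun x => 'chi_i x); split => //.
- by move=> x; rewrite -(lin_charV_conj lin_i) ?inE.
- exact: lin_char1 lin_i.
case: (boolP [forall x, 'chi_i x == 1]) => [/forallP triv | /forallPn[y chiy]].
  have /eqP : i = 0.
    by apply: irr_inj; apply/cfun_inP => x xF; rewrite (eqP (triv x)) irr0 cfun1E xF.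
  by [].
have /eqP : \sum_x 'chi_i x = 'chi_i y * \sum_x 'chi_i x.
  rewrite mulr_sumr [LHS](reindex_inj (addrI y)) /=.
  by apply: eq_bigr => x _; rewrite chiD.
rewrite -subr_eq0 -{1}[X in X - _]mul1r -mulrBl mulf_eq0 subr_eq0 eq_sym.
by rewrite (negPf chiy) /= => /eqP.
Qed.

(** Lagrange's identity: twice the difference of the two sides is the sum of the squares of
    [f i * g j - f j * g i]. *)
Lemma cauchy_schwarz_sum (K : numDomainType) (I : finType) (P : pred I) (f g : I -> K) :
  (forall i, f i \is Num.real) -> (forall i, g i \is Num.real) ->
  (\sum_(i | P i) f i * g i) ^+ 2
    <= (\sum_(i | P i) f i ^+ 2) * (\sum_(i | P i) g i ^+ 2).
Proof.
move=> fR gR.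
have sq (h k : I -> K) : (\sum_(i | P i) h i) * (\sum_(i | P i) k i)
    = \sum_(i | P i) \sum_(j | P j) h i * k j.
  by rewrite mulr_suml; apply: eq_bigr => i _; rewrite mulr_sumr.
rewrite -subr_ge0 -(pmulrn_lge0 _ (isT : (0 < 2)%N)) mulr2n expr2 !sq.
rewrite {2}exchange_big -!sumrB -big_split /=; apply: sumr_ge0 => i _.
rewrite -!sumrB -big_split /=; apply: sumr_ge0 => j _.
rewrite [X in 0 <= X](_ : _ = (f i * g j - f j * g i) ^+ 2); last by ring.
by rewrite real_exprn_even_ge0 // rpredB ?rpredM.
Qed.

Lemma normC_cauchy_schwarz (C : numClosedFieldType) (I : finType) (P : pred I) (f g : I -> C) :
  `|\sum_(i | P i) f i * g i| ^+ 2
    <= (\sum_(i | P i) `|f i| ^+ 2) * (\sum_(i | P i) `|g i| ^+ 2).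
Proof.
apply: le_trans (cauchy_schwarz_sum _ _ _) => [|i|i]; [|exact: normr_real..].
rewrite lerXn2r ?nnegrE ?sumr_ge0 // => [i _|]; first by rewrite mulr_ge0.
by apply: le_trans (ler_norm_sum _ _ _) _; apply: ler_sum => i _; rewrite normrM.
Qed.

(** * Convolution by a subset of SL_2: frequencies of a unipotent group *)

(** Left convolution by the indicator of [A]. If [f] counts the pairs with [b + d = x], the value at
    [y] counts the triples with [a (b + d) = y]. *)
Definition translate_sum (K : nmodType) (F : finFieldType) (A : {set 'M[F]_2})
  (f : 'M[F]_2 -> K) (y : 'M[F]_2) : K := \sum_(a in A) f (invmx a *m y).

Lemma det1_unitmx (F : fieldType) n (h : 'M[F]_n) : \det h = 1 -> h \in unitmx.
Proof. by rewrite unitmxE => ->; rewrite unitr1. Qed.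

Lemma sum_det_mulr (K : nmodType) (F : finFieldType) (t : F) (h : 'M[F]_2) (f : 'M[F]_2 -> K) :
  \det h = 1 -> \sum_(x | \det x == t) f (x *m h) = \sum_(x | \det x == t) f x.
Proof.
move=> h1; have hU := det1_unitmx h1.
rewrite [RHS](reindex (fun x => x *m h)) /=.
  by apply: eq_bigl => x; rewrite det_mulmx h1 mulr1.
by exists (fun x => x *m invmx h) => x _; rewrite ?mulmxK ?mulmxKV.
Qed.

Lemma sum_det_div (K : nmodType) (F : finFieldType) (t : F) (h : 'M[F]_2) (f : 'M[F]_2 -> K) :
  \det h = t -> t != 0 -> \sum_(a | \det a == 1) f (a *m h) = \sum_(x | \det x == t) f x.
Proof.
move=> ht t0; have hU : h \in unitmx by rewrite unitmxE ht unitfE.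
rewrite [RHS](reindex (fun a => a *m h)) /=.
  apply: eq_bigl => x; rewrite det_mulmx ht.
  by rewrite -[X in _ = (_ == X)]mul1r (inj_eq (mulIf t0)).
by exists (fun x => x *m invmx h) => x _; rewrite ?mulmxK ?mulmxKV.
Qed.

(** Substituting [x = invmx a *m y] turns the convolution into an operator with a 0-1 kernel on the
    coset [\det x == t], ready for Cauchy-Schwarz and Bessel. *)
Lemma translate_sum_indicator (K : pzSemiRingType) (F : finFieldType) (A : {set 'M[F]_2})
  (t : F) (f : 'M[F]_2 -> K) y : A \subset SL2 F -> \det y = t -> t != 0 ->
  translate_sum A f y = \sum_(x | \det x == t) (y *m invmx x \in A)%:R * f x.
Proof.
move=> AS yt t0.
rewrite -(sum_det_div _ yt t0) /translate_sum (reindex_onto (@invmx F 2) (@invmx F 2)) /=; last first.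
  by move=> a _; rewrite invmxK.
have yU : y \in unitmx by rewrite unitmxE yt unitfE.
rewrite (eq_bigl (fun a => (invmx a \in A) && (\det a == 1))); last first.
  move=> a; rewrite invmxK eqxx andbT; apply/idP/andP => [aA|[]//]; split=> //.
  move/subsetP: AS => /(_ _ aA); rewrite inE det_inv => /eqP/(congr1 GRing.inv).
  by rewrite invrK invr1 => ->.
rewrite [LHS]big_mkcondl /=; apply: eq_bigr => a /eqP a1.
have aU := det1_unitmx a1.
rewrite invmxK.
have -> : y *m invmx (a *m y) = invmx a.
  by rewrite -{1}(mulKmx aU y) mulmxK // unitmx_mul aU.
by case: ifP; rewrite ?mul1r ?mul0r.
Qed.

Lemma sum_indicator_div (K : pzSemiRingType) (F : finFieldType) (A : {set 'M[F]_2})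
  (t : F) y : A \subset SL2 F -> \det y = t -> t != 0 ->
  \sum_(x | \det x == t) ((y *m invmx x \in A)%:R : K) = #|A|%:R.
Proof.
move=> AS yt t0.
have := @translate_sum_indicator K F A t (fun=> 1) y AS yt t0.
rewrite /translate_sum sumr_const => ->; apply: eq_bigr => x _; by rewrite mulr1.
Qed.

Section UnipotentAverage.
Variables (C : numClosedFieldType) (F : finFieldType).
Variable psi : F -> C.
Hypothesis psiD : forall x y, psi (x + y) = psi x * psi y.
Hypothesis psiN : forall x, psi (- x) = (psi x)^*.
Hypothesis psi0 : psi 0 = 1.
Hypothesis psi_sum0 : \sum_x psi x = 0.
(** [u] stands for either the upper or the lower unipotent group; [dg] is a torus whose conjugation
    rescales the parameter of [u] by squares. *)
Variables (u dg : F -> 'M[F]_2).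
Hypothesis det_u : forall s, \det (u s) = 1.
Hypothesis uD : forall r s, u (r + s) = u r *m u s.
Hypothesis det_dg : forall s, s != 0 -> \det (dg s) = 1.
Hypothesis u_dg : forall s r, s != 0 -> u r *m dg s = dg s *m u (r / s ^+ 2).

Let q : C := #|F|%:R.

Let q_gt0 : 0 < q.
Proof. by rewrite ltr0n (ltn_trans _ (card_finNzRing_gt1 F)). Qed.

Let q_neq0 : q != 0. Proof. by rewrite lt0r_neq0. Qed.

Lemma char_orthogonality z : \sum_x psi (x * z) = if z == 0 then q else 0.
Proof.
case: eqVneq => [->|z0].
  by under eq_bigr do rewrite mulr0 psi0; rewrite sumr_const.
rewrite -[RHS]psi_sum0 [RHS](reindex_inj (mulIf z0)) /=.
exact: eq_bigr.
Qed.


Lemma char_parseval (f : F -> C) :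
  \sum_xi `|\sum_r (psi (xi * r))^* * f r| ^+ 2 = q * \sum_r `|f r| ^+ 2.
Proof.
transitivity (\sum_xi \sum_r \sum_s psi (xi * (s - r)) * (f r * (f s)^*)).
  apply: eq_bigr => xi _; rewrite normCK rmorph_sum mulr_suml.
  apply: eq_bigr => r _; rewrite mulr_sumr; apply: eq_bigr => s _.
  rewrite rmorphM /= conjCK mulrBr psiD psiN; ring.
rewrite exchange_big mulr_sumr; apply: eq_bigr => r _ /=.
rewrite exchange_big (bigD1 r) //= -mulr_suml char_orthogonality subrr eqxx -normCK.
rewrite big1 ?addr0 // => s sr.
by rewrite -mulr_suml char_orthogonality subr_eq0 (negPf sr) mul0r.
Qed.

(** Orthogonal projection onto the functions on which right translation by [u r] acts as the scalar
    [psi (xi * r)]; frequency 0 gives the average over [u]. *)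
Definition freq (xi : F) (f : 'M[F]_2 -> C) (x : 'M[F]_2) : C :=
  q^-1 * \sum_r (psi (xi * r))^* * f (x *m u r).

Definition sqnormC (t : F) (f : 'M[F]_2 -> C) : C := \sum_(x | \det x == t) `|f x| ^+ 2.

Lemma sqnormC_mulr t h f : \det h = 1 -> sqnormC t (fun x => f (x *m h)) = sqnormC t f.
Proof. by move=> h1; rewrite -[RHS](sum_det_mulr _ _ h1). Qed.

Lemma sqnormC_ge0 t f : 0 <= sqnormC t f.
Proof. by apply: sumr_ge0 => x _; rewrite exprn_ge0. Qed.

(** Parseval along each orbit [r |-> x *m u r], then summed over [x]. *)
Lemma sum_sqnormC_freq t f : \sum_xi sqnormC t (freq xi f) = sqnormC t f.
Proof.
rewrite /sqnormC exchange_big /=.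
under eq_bigr => x _.
  under eq_bigr do rewrite /freq normrM exprMn.
  rewrite -mulr_sumr char_parseval; over.
rewrite -mulr_sumr -mulr_sumr exchange_big /=.
under eq_bigr => r _ do rewrite (sum_det_mulr t (fun x => `|f x| ^+ 2) (det_u r)).
rewrite sumr_const -[X in _ * (_ * X)]mulr_natl normfV ger0_norm ?(ltW q_gt0) //.
by rewrite -/q; field.
Qed.

Lemma freq_translate xi f r x : freq xi f (x *m u r) = psi (xi * r) * freq xi f x.
Proof.
rewrite /freq mulrCA; congr (_ * _); rewrite mulr_sumr.
rewrite [RHS](reindex_inj (addrI r)) /=; apply: eq_bigr => s _.
rewrite -mulmxA -uD mulrA; congr (_ * _).
by rewrite -!psiN -psiD mulrDr; congr psi; ring.
Qed.

Definition has_freq xi (f : 'M[F]_2 -> C) := forall x r, f (x *m u r) = psi (xi * r) * f x.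

(** The projection [freq xi] is self-adjoint, so pairing with a function of frequency [xi] sees only
    that component of [g]. *)
Lemma sum_has_freq t xi f g : has_freq xi f ->
  \sum_(x | \det x == t) (f x)^* * g x = \sum_(x | \det x == t) (f x)^* * freq xi g x.
Proof.
move=> fxi.
transitivity (\sum_(x | \det x == t) q^-1 * \sum_r (f (x *m u r))^* * g (x *m u r)).
  rewrite -mulr_sumr exchange_big /=.
  under [in RHS]eq_bigr => r _ do rewrite (sum_det_mulr t (fun x => (f x)^* * g x) (det_u r)).
  by rewrite sumr_const -[X in _ = _ * X]mulr_natl mulKf.
apply: eq_bigr => x _; rewrite /freq [RHS]mulrCA; congr (_ * _); rewrite mulr_sumr.
by apply: eq_bigr => r _; rewrite fxi rmorphM /=; ring.
Qed.

(** The right translates of [f] by [dg s] have frequencies [xi / s ^+ 2], each shared by at most two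
    [s], and their convolutions all have the same norm because [A] acts on the left. At a fixed [y],
    Bessel bounds all [q - 1] values together by one kernel row of squared norm [#|A|], at the cost
    of a factor 2. *)
Lemma sqnormC_translate_sum_freq (A : {set 'M[F]_2}) t xi f :
  A \subset SL2 F -> t != 0 -> xi != 0 -> has_freq xi f ->
  (q - 1) * sqnormC t (translate_sum A f)
    <= 2 * #|A|%:R * (\sum_(x : 'M[F]_2 | \det x == t) 1) * sqnormC t f.
Proof.
move=> AS t0 xi0 fxi.
pose g s x := f (x *m dg s).
have gfreq s : s != 0 -> has_freq (xi / s ^+ 2) (g s).
  move=> s0 x r; rewrite /g -mulmxA u_dg // mulmxA fxi; congr (psi _ * _).
  by rewrite mulrA mulrAC.
have Eg s : s != 0 -> sqnormC t (g s) = sqnormC t f.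
  by move=> s0; apply: sqnormC_mulr; exact: det_dg.
have Tg s : s != 0 -> sqnormC t (translate_sum A (g s)) = sqnormC t (translate_sum A f).
  move=> s0; rewrite -[RHS](sqnormC_mulr _ _ (det_dg s0)); apply: eq_bigr => x _.
  by congr (`| _ | ^+ 2); apply: eq_bigr => a _; rewrite /g mulmxA.
pose k (y x : 'M[F]_2) : C := (y *m invmx x \in A)%:R.
have bessel y : \det y = t ->
    \sum_(s | s != 0) `|translate_sum A (g s) y| ^+ 2 <= 2 * #|A|%:R * sqnormC t f.
  move=> yt.
  have kE : sqnormC t (k y) = #|A|%:R.
    rewrite -(sum_indicator_div C AS yt t0); apply: eq_bigr => x _.
    by rewrite /k; case: (_ \in _); rewrite ?normr1 ?normr0 ?expr1n ?expr0n.
  have one s : s != 0 -> `|translate_sum A (g s) y| ^+ 2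
      <= sqnormC t f * sqnormC t (freq (xi / s ^+ 2) (k y)).
    move=> s0; rewrite (translate_sum_indicator _ AS yt t0) -norm_conjC rmorph_sum /=.
    under eq_bigr do rewrite rmorphM /= mulrC conjC_nat.
    rewrite (sum_has_freq t (k y) (gfreq s s0)).
    apply: le_trans (normC_cauchy_schwarz _ _ _) _.
    by under eq_bigr do rewrite norm_conjC; rewrite -/(sqnormC t (g s)) Eg.
  apply: le_trans (ler_sum _ one) _; rewrite -mulr_sumr mulrC; apply: ler_wpM2r; first exact: sqnormC_ge0.

  rewrite -kE -(sum_sqnormC_freq t (k y)).
  rewrite (partition_big (fun s => xi / s ^+ 2) predT) //= mulr_sumr; apply: ler_sum => eta _.
  rewrite (eq_bigr (fun=> sqnormC t (freq eta (k y)))); last by move=> s /andP[_ /eqP ->].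
  rewrite sumr_const -[X in X <= _]mulr_natl; apply: ler_wpM2r; first exact: sqnormC_ge0.
  rewrite ler_nat.
  case: (pickP (fun s : F => (s != 0) && (xi / s ^+ 2 == eta))) => [s0 /andP[s00 /eqP s0E]|no].
    apply: leq_trans (_ : #|[set s0; - s0]| <= 2)%N; last by rewrite cards2; case: eqP.
    apply/subset_leq_card/subsetP => s; rewrite !inE => /andP[sn /eqP sE].
    rewrite -eqf_sqr -(inj_eq invr_inj); apply/eqP/(mulfI xi0); by rewrite sE s0E.
  by rewrite eq_card0.
rewrite -[X in (q - X)](mul1r 1).
have -> : (q - 1 * 1) * sqnormC t (translate_sum A f)
    = \sum_(s : F | s != 0) sqnormC t (translate_sum A (g s)).
  rewrite (eq_bigr _ Tg) sumr_const cardC1 -mulr_natl mulr1.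
  by rewrite -subn1 natrB // (ltnW (card_finNzRing_gt1 F)).
rewrite /sqnormC exchange_big /= -/(sqnormC t f) mulrAC mulr_sumr.
by apply: ler_sum => y /eqP yt; rewrite mulr1; exact: bessel.
Qed.

(** Subtracting the average removes frequency 0 and keeps the others. Left convolution commutes with
    the projections, so the single-frequency bounds add up by Parseval. *)
Lemma sqnormC_translate_sum_sub (A : {set 'M[F]_2}) t f :
  A \subset SL2 F -> t != 0 ->
  (q - 1) * sqnormC t (translate_sum A (fun x => f x - q^-1 * \sum_r f (x *m u r)))
    <= 2 * #|A|%:R * (\sum_(x : 'M[F]_2 | \det x == t) 1) * sqnormC t f.
Proof.
move=> AS t0; set f' := fun x => _.
have freqT xi y : freq xi (translate_sum A f') y = translate_sum A (freq xi f') y.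
  rewrite /freq /translate_sum -mulr_sumr exchange_big; congr (_ * _).
  apply: eq_bigr => r _; rewrite mulr_sumr; apply: eq_bigr => a _.
  by rewrite mulmxA.
have freq0f x : q^-1 * \sum_r f (x *m u r) = freq 0 f x.
  by congr (_ * _); apply: eq_bigr => r _; rewrite mul0r psi0 conjC1 mul1r.
have freq_f' xi x : freq xi f' x = if xi == 0 then 0 else freq xi f x.
  transitivity (freq xi f x - freq xi (freq 0 f) x).
    rewrite /freq -mulrBr -sumrB; congr (_ * _); apply: eq_bigr => r _.
    by rewrite -mulrBr /f' freq0f.
  have -> : freq xi (freq 0 f) x = if xi == 0 then freq 0 f x else 0.
    rewrite {1}/freq.
    under eq_bigr do rewrite freq_translate mul0r psi0 mul1r -psiN -mulNr [- xi * _]mulrC.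
    rewrite -mulr_suml.
    rewrite char_orthogonality oppr_eq0; case: eqP => _; last by rewrite mul0r mulr0.
    by rewrite mulKf.
  by case: eqP => [->|_]; rewrite ?subrr ?subr0.
rewrite -sum_sqnormC_freq mulr_sumr -[X in _ <= _ * X]sum_sqnormC_freq mulr_sumr.
apply: ler_sum => xi _.
have -> : sqnormC t (freq xi (translate_sum A f')) = sqnormC t (translate_sum A (freq xi f')).
  by apply: eq_bigr => x _; rewrite freqT.
have [->|xi0] := eqVneq xi 0.
  rewrite [X in _ * X <= _]big1 ?mulr0.
    by rewrite !mulr_ge0 ?sqnormC_ge0 ?sumr_ge0 ?ler0n.
  by move=> x _; rewrite /translate_sum big1 ?normr0 ?expr0n // => a _; rewrite freq_f' eqxx.
have -> : sqnormC t (translate_sum A (freq xi f')) = sqnormC t (translate_sum A (freq xi f)).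
  apply: eq_bigr => x _; congr (`| _ | ^+ 2); apply: eq_bigr => a _.
  by rewrite freq_f' (negPf xi0).
apply: (sqnormC_translate_sum_freq AS t0 xi0) => x r; exact: freq_translate.
Qed.

End UnipotentAverage.

(** * Hyperplane sections of SL_2 *)

Definition mx22 (K : Type) (a b c d : K) : 'M[K]_2 :=
  \matrix_(i, j) if i == 0 then if j == 0 then a else b else if j == 0 then c else d.

Lemma mx22_eta (K : Type) (x : 'M[K]_2) : x = mx22 (x 0 0) (x 0 1) (x 1 0) (x 1 1).
Proof.
apply/matrixP => i j; rewrite mxE.
by case: i => [[|[|i]] // hi]; case: j => [[|[|j]] // hj] /=; congr (x _ _); exact: val_inj.
Qed.

Lemma mx22_add (K : nmodType) (a b c d a' b' c' d' : K) :
  mx22 a b c d + mx22 a' b' c' d' = mx22 (a + a') (b + b') (c + c') (d + d').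
Proof. by apply/matrixP => i j; rewrite !mxE; case: (i == 0); case: (j == 0). Qed.

Lemma mx22_mul (K : pzRingType) (a b c d a' b' c' d' : K) :
  mx22 a b c d *m mx22 a' b' c' d'
  = mx22 (a * a' + b * c') (a * b' + b * d') (c * a' + d * c') (c * b' + d * d').
Proof.
apply/matrixP => i j; rewrite !mxE !big_ord_recl big_ord0 !mxE /= addr0.
by case: (i == 0); case: (j == 0).
Qed.

Lemma det_mx22 (K : comPzRingType) (a b c d : K) : \det (mx22 a b c d) = a * d - b * c.
Proof.
rewrite (expand_det_row _ 0) !big_ord_recl big_ord0 /cofactor !det_mx11 !mxE /=.
by rewrite addr0 expr0 expr1 !mul1r mulN1r mulrN.
Qed.

Lemma sum_mx22 (V : nmodType) (F : finFieldType) (P : pred 'M[F]_2) (f : 'M[F]_2 -> V) :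
  \sum_(x | P x) f x = \sum_(v : F * F) \sum_(w : F * F | P (mx22 v.1 v.2 w.1 w.2))
    f (mx22 v.1 v.2 w.1 w.2).
Proof.
rewrite pair_big_dep /=.
rewrite (reindex (fun vw : (F * F) * (F * F) => mx22 vw.1.1 vw.1.2 vw.2.1 vw.2.2)) //.
exists (fun x : 'M[F]_2 => ((x 0 0, x 0 1), (x 1 0, x 1 1))) => x _ /=.
  by case: x => [[a b] [c d]]; rewrite !mxE.
by rewrite [RHS]mx22_eta.
Qed.

Lemma card_line (F : finFieldType) (a b k : F) : (a, b) != (0, 0) ->
  #|[set w : F * F | a * w.1 + b * w.2 == k]| = #|F|.
Proof.
move=> ab0; have [b0|b0] := eqVneq b 0.
  have a0 : a != 0 by apply: contraNneq ab0 => ->; rewrite b0.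
  rewrite -cardsT -(card_imset _ (_ : injective (fun y : F => (k / a, y)))) => [|y y' []//].
  apply: eq_card => -[x y]; rewrite !inE b0 /= mul0r addr0.
  apply/eqP/imsetP => [<-|[y' _ [-> _]]]; last by rewrite mulrC divfK.
  by exists y; rewrite // mulrAC divff // mul1r.
rewrite -cardsT -(card_imset _ (_ : injective (fun x : F => (x, (k - a * x) / b)))) => [|y y' []//].
apply: eq_card => -[x y]; rewrite !inE /=.
apply/eqP/imsetP => [<-|[x' _ [-> ->]]]; last by field.
by exists x => //; congr (_, _); field.
Qed.

Lemma card_det1_rows (F : finFieldType) (v : F * F) :
  #|[set w : F * F | v.1 * w.2 - v.2 * w.1 == 1]| = if v == (0, 0) then 0%N else #|F|.
Proof.
case: eqP => [->|/eqP v0] /=.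
  apply/eqP; rewrite cards_eq0; apply/eqP/setP => w; rewrite !inE !mul0r subrr eq_sym.
  exact: oner_eq0.
rewrite -(@card_line _ (- v.2) v.1 1).
  by apply: eq_card => w; rewrite !inE mulNr addrC.
by move: v0; rewrite !xpair_eqE oppr_eq0 andbC; case: v.
Qed.

Lemma card_SL2 (F : finFieldType) : #|SL2 F| = (#|F| * (#|F| ^ 2 - 1))%N.
Proof.
have -> : #|SL2 F| = (\sum_(v : F * F) #|[set w : F * F | (v.1 * w.2 - v.2 * w.1 == 1)%R]|)%N.
  have := @sum_mx22 nat F (fun x => \det x == 1) (fun=> 1%N).
  rewrite -sum1dep_card => ->; apply: eq_bigr => v _.
  by rewrite sum1dep_card; apply: eq_card => w; rewrite !inE det_mx22.
under eq_bigr do rewrite card_det1_rows.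
rewrite (bigD1 (0, 0)) //= eqxx add0n (eq_bigr (fun=> #|F|)); last by move=> v /negPf ->.
by rewrite sum_nat_const cardC1 card_prod mulnC -subn1.
Qed.

(* A first row [v] leaves at most one second row, unless [v.1 * c + v.2 * d = 0]: then
   [v = (l * d, - l * c)] with [l] a root of a quadratic, so at most two such rows occur. *)
Lemma card_SL2_slice_rows (F : finFieldType) (p r c d k : F) : (c, d) != (0, 0) ->
  (\sum_(v : F * F) #|[set w : F * F | (v.1 * w.2 - v.2 * w.1 == 1)%R
     && (p * v.1 + r * v.2 + c * w.1 + d * w.2 == k)%R]| <= #|F| ^ 2 + 2 * #|F|)%N.
Proof.
move=> cd0.
pose n (v : F * F) := #|[set w : F * F | (v.1 * w.2 - v.2 * w.1 == 1)
     && (p * v.1 + r * v.2 + c * w.1 + d * w.2 == k)]|.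
rewrite -[X in (X <= _)%N]/(\sum_(v : F * F) n v)%N.
pose bad := [set v : F * F | (v.1 * c + v.2 * d == 0) && (n v != 0)%N].
have nq v : (n v <= #|F|)%N.
  rewrite -(@card_line _ c d (k - p * v.1 - r * v.2) cd0).
  apply/subset_leq_card/subsetP => w; rewrite !inE => /andP[_ /eqP <-].
  by apply/eqP; ring.
have n1 v : v.1 * c + v.2 * d != 0 -> (n v <= 1)%N.
  move=> v0; apply/card_le1_eqP => w w'; rewrite !inE.
  move=> /andP[/eqP e1 /eqP e2] /andP[/eqP e1' /eqP e2'].
  (* Cramer's rule: the two equations are linear in [w], with determinant [v.1 * c + v.2 * d]. *)
  have d1 : (v.1 * c + v.2 * d) * (w.1 - w'.1) = 0.
    have -> : (v.1 * c + v.2 * d) * (w.1 - w'.1) =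
      v.1 * ((p * v.1 + r * v.2 + c * w.1 + d * w.2) - (p * v.1 + r * v.2 + c * w'.1 + d * w'.2))
      - d * ((v.1 * w.2 - v.2 * w.1) - (v.1 * w'.2 - v.2 * w'.1)) by ring.
    by rewrite e1 e1' e2 e2' !subrr !mulr0 subrr.
  have d2 : (v.1 * c + v.2 * d) * (w.2 - w'.2) = 0.
    have -> : (v.1 * c + v.2 * d) * (w.2 - w'.2) =
      v.2 * ((p * v.1 + r * v.2 + c * w.1 + d * w.2) - (p * v.1 + r * v.2 + c * w'.1 + d * w'.2))
      + c * ((v.1 * w.2 - v.2 * w.1) - (v.1 * w'.2 - v.2 * w'.1)) by ring.
    by rewrite e1 e1' e2 e2' !subrr !mulr0 addr0.
  move/eqP: d1; move/eqP: d2; rewrite !mulf_eq0 !(negPf v0) /= !subr_eq0 => /eqP h2 /eqP h1.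
  by case: w w' h1 h2 {e1 e2 e1' e2'} => [? ?] [? ?] /= -> ->.
have bad2 : (#|bad| <= 2)%N.
  pose g l : F * F := (l * d, - (l * c)).
  pose e := p * d - r * c.
  have badE v : v \in bad -> exists2 l, v = g l & l * (k - l * e) = 1.
    rewrite inE => /andP[/eqP v0]; rewrite cards_eq0 => /set0Pn[w].
    rewrite inE => /andP[/eqP e1 /eqP e2].
    have [l vE] : exists l, v = g l.
      have [c0|c0] := eqVneq c 0.
        have d0 : d != 0 by apply: contraNneq cd0 => ->; rewrite c0.
        exists (v.1 / d); rewrite /g divfK // c0 mulr0 oppr0.
        move/eqP: v0; rewrite c0 mulr0 add0r mulf_eq0 (negPf d0) orbF => /eqP <-.
        by case: (v).
      exists (- v.2 / c); rewrite /g divfK // opprK.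
      have -> : - v.2 / c * d = v.1.
        by apply: (mulIf c0); rewrite -(subr0 (v.1 * c)) -v0; field.
      by case: (v).
    exists l => //; rewrite -e1 -e2 vE /g /e /=; ring.
  case: (set_0Vmem bad) => [->|[v /badE[l vE lE]]]; first by rewrite cards0.
  (* By Vieta, [k / e - l] is the other root of [e * l ^+ 2 - k * l + 1]. If [e = 0] the equation is
     linear and [l] is the only root. *)
  apply: leq_trans (_ : #|[set g l; g (k / e - l)%R]| <= 2)%N; last by rewrite cards2; case: eqP.
  apply/subset_leq_card/subsetP => v' /badE[l' -> l'E]; rewrite !inE.
  have : (l' - l) * (k - e * (l' + l)) = 0.
    by rewrite -[RHS](subrr 1) -{1}l'E -lE; ring.
  move/eqP; rewrite mulf_eq0 !subr_eq0 => /orP[/eqP ->|/eqP kE]; first by rewrite eqxx.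
  have [e0|e0] := eqVneq e 0.
    move: lE; rewrite kE e0 mul0r mulr0 subrr mulr0 => /eqP; by rewrite eq_sym oner_eq0.
  by apply/orP; right; rewrite kE [e * _]mulrC mulfK // addrK.
(* One solution for each of the [#|F| ^ 2] rows, plus at most [#|F|] for each of the at most two bad
   rows. *)
apply: (@leq_trans (\sum_(v : F * F) (1 + (v \in bad) * #|F|))%N).
  apply: leq_sum => v _; case: (boolP (v \in bad)) => vb.
    by rewrite mul1n (leq_trans (nq v)) // leq_addl.
  rewrite mul0n addn0; have [v0|v0] := eqVneq (v.1 * c + v.2 * d) 0; last exact: n1.
  by move: vb; rewrite inE v0 eqxx /= negbK => /eqP ->.
rewrite big_split /= sum_nat_const card_prod muln1 -mulnn leq_add2l -big_distrl /=.
rewrite leq_mul2r -big_mkcond sum1_card bad2; exact: orbT.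
Qed.

(** The bilinear polar form of the quadratic form [\det]: for [y != 0], fixing [det_pol s y]
    confines [s] to a hyperplane. *)
Definition det_pol (K : comPzRingType) (x y : 'M[K]_2) : K := \det (x + y) - \det x - \det y.

Lemma det_pol_mx22 (K : comPzRingType) (a b c d a' b' c' d' : K) :
  det_pol (mx22 a b c d) (mx22 a' b' c' d') = a * d' + d * a' - b * c' - c * b'.
Proof. by rewrite /det_pol mx22_add !det_mx22; ring. Qed.

Lemma det_pol_subr (K : comPzRingType) (x y z : 'M[K]_2) :
  det_pol x (y - z) = det_pol x y - det_pol x z.
Proof.
have -> : y - z = mx22 (y 0 0 - z 0 0) (y 0 1 - z 0 1) (y 1 0 - z 1 0) (y 1 1 - z 1 1).
  by rewrite [LHS]mx22_eta !mxE.
by rewrite (mx22_eta x) (mx22_eta y) (mx22_eta z) !det_pol_mx22 !mxE /=; ring.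
Qed.

(** Counting by rows needs a nonzero first row of [y]. Otherwise left multiplication by the quarter
    turn [W], which preserves [\det] and [det_pol], brings the second row to the top. *)
Lemma card_SL2_slice (F : finFieldType) (y : 'M[F]_2) k : y != 0 ->
  (#|[set s in SL2 F | det_pol s y == k]| <= #|F| ^ 2 + 2 * #|F|)%N.
Proof.
have row1 (z : 'M[F]_2) : (- z 0 1, z 0 0) != (0, 0) ->
    (#|[set s in SL2 F | det_pol s z == k]| <= #|F| ^ 2 + 2 * #|F|)%N.
  move=> z0; apply: leq_trans (card_SL2_slice_rows (z 1 1) (- z 1 0) k z0).
  have := @sum_mx22 nat F (fun s => (\det s == 1) && (det_pol s z == k)) (fun=> 1%N).
  rewrite sum1dep_card => E; apply: eq_leq.
  transitivity #|[set x : 'M[F]_2 | \det x == 1 & det_pol x z == k]|.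
    by apply: eq_card => s; rewrite !inE.
  rewrite E; apply: eq_bigr => v _; rewrite sum1dep_card; apply: eq_card => w.
  rewrite !inE det_mx22 [X in det_pol _ X]mx22_eta det_pol_mx22.
  by congr (_ && (_ == k)); ring.
move=> y0; have [row0|] := eqVneq (- y 0 1, y 0 0) (0, 0); last exact: row1.
pose W : 'M[F]_2 := mx22 0 1 (-1) 0.
have W1 : \det W = 1 by rewrite det_mx22 mul0r mul1r opprK add0r.
have WE : W *m y = mx22 (y 1 0) (y 1 1) (- y 0 0) (- y 0 1).
  by rewrite /W {1}(mx22_eta y) mx22_mul; congr mx22; ring.
have polW s z : det_pol (W *m s) (W *m z) = det_pol s z.
  by rewrite /det_pol -mulmxDr !det_mulmx W1 !mul1r.
apply: leq_trans (row1 (W *m y) _).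
  rewrite -(card_imset _ (_ : injective (mulmx W))); last exact: (can_inj (mulKmx (det1_unitmx W1))).
  apply/subset_leq_card/subsetP => _ /imsetP[s + ->].
  by rewrite !inE polW det_mulmx W1 mul1r.
apply: contra y0; rewrite WE !mxE /= => /eqP[/eqP + /eqP y10].
case: row0 => /eqP; rewrite !oppr_eq0 => /eqP y01 y00 /eqP y11.
by rewrite (mx22_eta y) y01 y00 y11 (eqP y10); apply/eqP/matrixP => i j; rewrite !mxE !if_same.
Qed.

(** * Convolution by a subset of SL_2: mean-zero functions *)

Section MeanZero.
Variable F : finFieldType.
Implicit Types (A : {set 'M[F]_2}) (f h : 'M[F]_2 -> rat) (t : F).

Let q : rat := #|F|%:R.

Let q_gt1 : 1 < q. Proof. by rewrite ltr1n card_finNzRing_gt1. Qed.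

Definition sqnorm t f : rat := \sum_(x | \det x == t) f x ^+ 2.

Definition average (u : F -> 'M[F]_2) f x : rat := q^-1 * \sum_r f (x *m u r).

Definition upper r : 'M[F]_2 := mx22 1 r 0 1.
Definition lower r : 'M[F]_2 := mx22 1 0 r 1.

Lemma det_upper r : \det (upper r) = 1.
Proof. by rewrite det_mx22 mulr1 mulr0 subr0. Qed.

Lemma det_lower r : \det (lower r) = 1.
Proof. by rewrite det_mx22 mulr1 mul0r subr0. Qed.

Lemma upperD r s : upper (r + s) = upper r *m upper s.
Proof. by rewrite mx22_mul; congr mx22; ring. Qed.

Lemma lowerD r s : lower (r + s) = lower r *m lower s.
Proof. by rewrite mx22_mul; congr mx22; ring. Qed.

Lemma sqnorm_ge0 t f : 0 <= sqnorm t f.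
Proof. by apply: sumr_ge0 => x _; rewrite sqr_ge0. Qed.

Lemma exists_det t : exists h : 'M[F]_2, \det h = t.
Proof. by exists (mx22 t 0 0 1); rewrite det_mx22 mulr1 mulr0 subr0. Qed.

Lemma sum_det_const (K : pzSemiRingType) t : t != 0 ->
  \sum_(x : 'M[F]_2 | \det x == t) 1 = #|SL2 F|%:R :> K.
Proof.
move=> t0; have [h ht] := exists_det t.
by rewrite -(sum_det_div _ ht t0) -sumr_const; apply: eq_bigl => x; rewrite inE.
Qed.

Lemma card_SL2_rat : #|SL2 F|%:R = q * (q - 1) * (q + 1).
Proof.
rewrite card_SL2 natrM natrB ?natrX ?expn_gt0 ?(ltnW (card_finNzRing_gt1 F)) //.
by rewrite /q; ring.
Qed.

(** Characters take values in [algC], but both sides of the bound are rational, so it descends along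
    [ratr]. The factor [q - 1] cancels against [#|SL2 F| = q (q - 1) (q + 1)]. *)
Lemma sqnorm_translate_sum_sub A t u dg f :
  (forall s, \det (u s) = 1) -> (forall r s, u (r + s) = u r *m u s) ->
  (forall s, s != 0 -> \det (dg s) = 1) ->
  (forall s r, s != 0 -> u r *m dg s = dg s *m u (r / s ^+ 2)) ->
  A \subset SL2 F -> t != 0 ->
  sqnorm t (translate_sum A (fun x => f x - average u f x))
    <= 2 * #|A|%:R * q * (q + 1) * sqnorm t f.
Proof.
move=> u1 uD dg1 udg AS t0.
have [psi [psiD psiN psi0 psis]] := nontrivial_additive_character F.
have := sqnormC_translate_sum_sub psiD psiN psi0 psis u1 uD dg1 udg (ratr \o f) AS t0.
have ratrE g (g' : 'M[F]_2 -> algC) : (forall x, g' x = ratr (g x)) ->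
    sqnormC t g' = ratr (sqnorm t g).
  move=> gE; rewrite /sqnorm rmorph_sum; apply: eq_bigr => x _ /=.
  by rewrite gE -ratr_norm -rmorphXn /= real_normK ?num_real.
rewrite (sum_det_const _ t0).
rewrite (ratrE f (ratr \o f)) //.
rewrite (ratrE (translate_sum A (fun x => f x - average u f x)) (translate_sum A _)); last first.
  move=> x; rewrite rmorph_sum; apply: eq_bigr => a _ /=.
  by rewrite rmorphB rmorphM fmorphV rmorph_nat rmorph_sum.
set X := sqnorm _ (translate_sum _ _); set Y := sqnorm _ f => H.
have {}H : (q - 1) * X <= 2 * #|A|%:R * #|SL2 F|%:R * Y.
  rewrite -(ler_rat algC) !rmorphM rmorphB rmorph1 /=.
  by rewrite !ratr_nat.
rewrite card_SL2_rat in H.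
have q1 : 0 < q - 1 by rewrite subr_gt0 q_gt1.
rewrite -(ler_pM2l q1); apply: le_trans H _.
by rewrite le_eqVlt; apply/orP; left; apply/eqP; ring.
Qed.

Lemma sqnorm_translate_sum_upper A t f : A \subset SL2 F -> t != 0 ->
  sqnorm t (translate_sum A (fun x => f x - average upper f x))
    <= 2 * #|A|%:R * q * (q + 1) * sqnorm t f.
Proof.
apply: (@sqnorm_translate_sum_sub _ _ _ (fun s => mx22 s 0 0 s^-1)).
- exact: det_upper.
- exact: upperD.
- by move=> s s0; rewrite det_mx22 mulr0 subr0 divff.
- by move=> s r s0; rewrite !mx22_mul; congr mx22; field.
Qed.

Lemma sqnorm_translate_sum_lower A t f : A \subset SL2 F -> t != 0 ->
  sqnorm t (translate_sum A (fun x => f x - average lower f x))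
    <= 2 * #|A|%:R * q * (q + 1) * sqnorm t f.
Proof.
(* The torus is inverted so that its conjugation again divides the parameter by [s ^+ 2]. *)
apply: (@sqnorm_translate_sum_sub _ _ _ (fun s => mx22 s^-1 0 0 s)).
- exact: det_lower.
- exact: lowerD.
- by move=> s s0; rewrite det_mx22 mulr0 subr0 mulVf.
- by move=> s r s0; rewrite !mx22_mul; congr mx22; field.
Qed.

(** The Hilbert-Schmidt bound: each of the [#|SL2 F|] kernel rows has squared norm [#|A|]. *)
Lemma sqnorm_translate_sum A t f : A \subset SL2 F -> t != 0 ->
  sqnorm t (translate_sum A f) <= #|SL2 F|%:R * #|A|%:R * sqnorm t f.
Proof.
move=> AS t0; rewrite -mulrA -(sum_det_const _ t0) mulr_suml.
apply: ler_sum => y /eqP yt; rewrite mul1r (translate_sum_indicator _ AS yt t0).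
apply: le_trans (cauchy_schwarz_sum _ _ _) _ => [i|i|]; rewrite ?num_real //.
rewrite -(sum_indicator_div _ AS yt t0) ler_wpM2r ?sqnorm_ge0 //.
by apply: ler_sum => x _; case: (_ \in _); rewrite ?expr1n ?expr0n.
Qed.

Lemma sqnorm_average_le t u f : (forall s, \det (u s) = 1) ->
  sqnorm t (average u f) <= sqnorm t f.
Proof.
move=> u1.
have -> : sqnorm t f = q^-1 * \sum_r \sum_(x | \det x == t) f (x *m u r) ^+ 2.
  under eq_bigr => r _ do rewrite (sum_det_mulr t (fun x => f x ^+ 2) (u1 r)).
  by rewrite sumr_const -[X in _ * X]mulr_natl mulKf // lt0r_neq0 // (lt_trans ltr01).
rewrite exchange_big mulr_sumr; apply: ler_sum => x _ /=.
have := @cauchy_schwarz_sum rat F xpredT (fun=> 1) (fun r => f (x *m u r)).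
move=> /(_ (fun=> num_real _) (fun=> num_real _)).
rewrite /= expr1n sumr_const; under eq_bigr do rewrite mul1r.
rewrite -/q.
have q0 : 0 < q by apply: lt_trans q_gt1.
move=> H; rewrite /average exprMn -(ler_pM2l (exprn_gt0 2 q0)) mulrA -exprMn divff ?lt0r_neq0 //.
rewrite expr1n mul1r; apply: le_trans H _.
by rewrite expr2 -!mulrA mulVKf ?lt0r_neq0.
Qed.

Lemma sum_det_divl (K : nmodType) t (x : 'M[F]_2) (f : 'M[F]_2 -> K) :
  \det x = t -> t != 0 -> \sum_(g | \det g == 1) f (x *m g) = \sum_(y | \det y == t) f y.
Proof.
move=> xt t0; have xU : x \in unitmx by rewrite unitmxE xt unitfE.
rewrite [RHS](reindex (mulmx x)) /=.
  apply: eq_bigl => g; rewrite det_mulmx xt.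
  by rewrite -[X in _ = (_ == X)]mulr1 (inj_eq (mulfI t0)).
by exists (mulmx (invmx x)) => g _; rewrite ?mulKmx ?mulKVmx.
Qed.

Let diag (s : F) : 'M[F]_2 := mx22 s 0 0 s^-1.

(* Expand the left side into correlations of [h] with its translates by the
   matrices [lower r].  For [r != 0] such a correlation is constant on the double
   coset of [lower r] modulo [upper], and these double cosets fill the big Bruhat
   cell; as [h] sums to zero, the total over the big cell is minus the total over
   the Borel subgroup, which is a square average, hence nonnegative. *)
Lemma sqnorm_average_lower t h : t != 0 -> (forall x r, h (x *m upper r) = h x) ->
  \sum_(x | \det x == t) h x = 0 ->
  q * sqnorm t (average lower h) <= sqnorm t h.
Proof.
move=> t0 hU h0.
have q0 : q != 0 by rewrite lt0r_neq0 // (lt_trans ltr01).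
pose corr g := \sum_(x | \det x == t) h x * h (x *m g).
have corrM g a : \det a = 1 ->
    \sum_(x | \det x == t) h (x *m a) * h (x *m a *m g) = corr g.
  by move=> a1; rewrite (sum_det_mulr t (fun x => h x * h (x *m g)) a1).
have corrU a b g : corr (upper a *m g *m upper b) = corr g.
  rewrite -(corrM g _ (det_upper a)); apply: eq_bigr => x _.
  by rewrite !mulmxA !hU.
have -> : q * sqnorm t (average lower h) = \sum_r corr (lower r).
  apply: (mulfI q0); rewrite mulrA -expr2 /sqnorm mulr_sumr.
  transitivity (\sum_(x | \det x == t) \sum_r \sum_s h (x *m lower r) * h (x *m lower s)).
    apply: eq_bigr => x _; rewrite /average exprMn mulrA -exprMn divff // expr1n mul1r.
    by rewrite expr2 mulr_suml; apply: eq_bigr => r _; rewrite mulr_sumr.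
  rewrite exchange_big /= mulr_natl -sumr_const; apply: eq_bigr => r _.
  rewrite exchange_big /= [LHS](reindex_inj (addrI r)) /=; apply: eq_bigr => s _.
  rewrite -(corrM _ _ (det_lower r)); apply: eq_bigr => x _.
  by rewrite lowerD mulmxA.
rewrite (bigD1 0) //=.
have -> : corr (lower 0) = sqnorm t h.
  apply: eq_bigr => x _; rewrite expr2; congr (_ * h _).
  by rewrite [RHS]mx22_eta [X in X *m _]mx22_eta mx22_mul; congr mx22; ring.
(* The term [r = 0] is already the right side, so the remaining correlations must sum to at most
   zero. *)
rewrite gerDl.
have total : \sum_(g | \det g == 1) corr g = 0.
  rewrite exchange_big /= big1 // => x /eqP xt.
  by rewrite -mulr_sumr (sum_det_divl _ xt t0) h0 mulr0.
have bigcell c : c != 0 -> \sum_(g | (\det g == 1) && (g 1 0 == c)) corr g = q ^+ 2 * corr (lower c).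
  move=> c0.
  (* Bruhat coordinates: the diagonal entries of the product are [1 + p.1 * c] and [1 + c * p.2],
     and the determinant fixes the last entry. *)
  rewrite (reindex_onto (fun p : F * F => upper p.1 *m lower c *m upper p.2)
     (fun g => ((g 0 0 - 1) / c, (g 1 1 - 1) / c))) /=; last first.
    move=> g /andP[/eqP g1 /eqP gc]; have gE := mx22_eta g; rewrite gc in gE.
    move: g1; rewrite [X in \det X]gE [X in _ -> _ = X]gE.
    rewrite det_mx22 !mx22_mul => g1.
    have bE : g 0 1 = (g 0 0 * g 1 1 - 1) / c by apply: (canRL (mulfK c0)); rewrite -g1; ring.
    by rewrite bE; congr mx22; field.
  rewrite (eq_bigl xpredT).
    under eq_bigr do rewrite corrU.
    by rewrite sumr_const -[LHS]mulr_natl card_prod natrM -expr2.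
  move=> [a b]; rewrite !det_mulmx !det_upper det_lower !mulr1 eqxx !mx22_mul !mxE /=.
  rewrite mul0r mulr0 mulr1 add0r !mul1r !addr0 eqxx /=; apply/eqP; congr (_, _); field => //.
have borel : \sum_(g | (\det g == 1) && (g 1 0 == 0)) corr g = q * \sum_(s | s != 0) corr (diag s).
  rewrite (reindex_onto (fun p : F * F => diag p.1 *m upper p.2)
     (fun g => (g 0 0, g 0 1 / g 0 0))) /=; last first.
    move=> g /andP[/eqP g1 /eqP gc]; have gE := mx22_eta g; rewrite gc in gE.
    move: g1; rewrite [X in \det X]gE [X in _ -> _ = X]gE.
    rewrite det_mx22 mulr0 subr0 !mx22_mul => g1.
    have a0 : g 0 0 != 0 by apply: contraTneq (oner_neq0 F) => g0; rewrite -g1 g0 mul0r eqxx.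
    have dE : g 1 1 = (g 0 0)^-1 by apply: (mulfI a0); rewrite g1 divff.
    by rewrite dE; congr mx22; field.
  rewrite (eq_bigl (fun p : F * F => (p.1 != 0) && true)).
    rewrite -(pair_big (fun a : F => a != 0) xpredT (fun a b => corr (diag a *m upper b))) /=.
    rewrite mulr_sumr; apply: eq_bigr => s _.
    have E b : corr (diag s *m upper b) = corr (diag s).
      by apply: eq_bigr => x _; rewrite mulmxA hU.
    by under eq_bigr do rewrite E; rewrite sumr_const -[LHS]mulr_natl.
  move=> [a b]; rewrite det_mulmx det_upper mulr1 det_mx22 mulr0 subr0 !mx22_mul !mxE /=.
  rewrite !mulr0 !mul0r !mulr1 !addr0 eqxx !andbT /=.
  have [->|a0] := eqVneq a 0; first by rewrite mul0r eq_sym oner_eq0.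
  by rewrite divff // eqxx /=; apply/eqP; congr (_, _); field.
have borel_ge0 : 0 <= \sum_(s | s != 0) corr (diag s).
  have q1 : 0 < q - 1 by rewrite subr_gt0.
  rewrite -(pmulr_rge0 _ q1).
  (* When the square is opened, the pair [(s, s * r)] contributes the correlation at [diag r], for
     each of the [q - 1] values of [s]. *)
  have -> : (q - 1) * \sum_(s | s != 0) corr (diag s)
      = \sum_(x | \det x == t) (\sum_(s | s != 0) h (x *m diag s)) ^+ 2.
    under [RHS]eq_bigr => x _.
      rewrite expr2 mulr_suml; under eq_bigr do rewrite mulr_sumr; over.
    rewrite [RHS]exchange_big /=.
    rewrite [RHS](eq_bigr (fun=> \sum_(s | s != 0) corr (diag s))).
      rewrite sumr_const cardC1 -[RHS]mulr_natl; congr (_ * _).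
      by rewrite -subn1 natrB // ltnW ?card_finNzRing_gt1.
    move=> s s0; rewrite exchange_big /= [LHS](reindex_inj (mulfI s0)) /=.
    apply: eq_big => r; first by rewrite mulf_eq0 (negPf s0).
    rewrite mulf_eq0 (negPf s0) /= => r0.
    have s1 : \det (diag s) = 1 by rewrite det_mx22 mulr0 subr0 divff.
    rewrite -(corrM _ _ s1); apply: eq_bigr => x _; congr (_ * h _).
    by rewrite -mulmxA; congr (_ *m _); rewrite mx22_mul; congr mx22; field; rewrite ?s0 ?r0.
  by apply: sumr_ge0 => x _; rewrite sqr_ge0.
have q20 : 0 < q ^+ 2 by rewrite exprn_even_gt0 //= lt0r_neq0 // (lt_trans ltr01).
rewrite -(pmulr_rle0 _ q20) mulr_sumr.
rewrite (eq_bigr (fun c => \sum_(g | (\det g == 1) && (g 1 0 == c)) corr g)); last first.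
  by move=> c c0; rewrite bigcell.
move: total; rewrite (partition_big (fun g : 'M[F]_2 => g 1 0) predT) //= (bigD1 0) //= borel.
move/eqP; rewrite addr_eq0 => /eqP E.
by rewrite -oppr_ge0 -E mulr_ge0 // (le_trans ler01) // ltW.
Qed.

Lemma average_upper_invariant f x r : average upper f (x *m upper r) = average upper f x.
Proof.
rewrite /average [in RHS](reindex_inj (addrI r)) /=; congr (_ * _).
by apply: eq_bigr => s _; rewrite upperD mulmxA.
Qed.

Lemma sum_average_upper t f :
  \sum_(x | \det x == t) average upper f x = \sum_(x | \det x == t) f x.
Proof.
rewrite /average -mulr_sumr exchange_big /=.
under eq_bigr => r _ do rewrite (sum_det_mulr t f (det_upper r)).
by rewrite sumr_const -[X in _ * X]mulr_natl mulKf // lt0r_neq0 // (lt_trans ltr01).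
Qed.

(** Split [f] as [(f - f1) + (f1 - f2) + f2]. The first two pieces cost [4 * q ^+ 2] each by the
    torus argument; for [f2] the Hilbert-Schmidt loss of order [q ^+ 3] is offset by the contraction
    [q^-1]. Hence [27 = 3 * (4 + 4 + 1)]. *)
Lemma sqnorm_translate_sum_mean_zero A t f : A \subset SL2 F -> t != 0 ->
  \sum_(x | \det x == t) f x = 0 ->
  sqnorm t (translate_sum A f) <= 27 * q ^+ 2 * #|A|%:R * sqnorm t f.
Proof.
move=> AS t0 f0.
pose f1 := average upper f; pose f2 := average lower f1.
have f10 : \sum_(x | \det x == t) f1 x = 0 by rewrite sum_average_upper.
have n1 : sqnorm t f1 <= sqnorm t f := sqnorm_average_le t f det_upper.
have n2 : q * sqnorm t f2 <= sqnorm t f1.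
  by apply: sqnorm_average_lower => //; exact: average_upper_invariant.
have b1 := sqnorm_translate_sum_upper f AS t0.
have b2 := sqnorm_translate_sum_lower f1 AS t0.
have b3 := sqnorm_translate_sum f2 AS t0.
have split3 : sqnorm t (translate_sum A f) <=
    3 * (sqnorm t (translate_sum A (fun x => f x - f1 x))
       + sqnorm t (translate_sum A (fun x => f1 x - f2 x)) + sqnorm t (translate_sum A f2)).
  rewrite /sqnorm -!big_split /= mulr_sumr; apply: ler_sum => x _.
  have -> : translate_sum A f x = translate_sum A (fun x => f x - f1 x) x
      + translate_sum A (fun x => f1 x - f2 x) x + translate_sum A f2 x.
    by rewrite /translate_sum -!big_split; apply: eq_bigr => a _ /=; ring.
  set a := translate_sum _ _ _; set b := translate_sum _ _ _; set c := translate_sum _ _ _.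
  by have := sqr_ge0 (a - b); have := sqr_ge0 (a - c); have := sqr_ge0 (b - c); nra.
have A0 : 0 <= (#|A|%:R : rat) by [].
apply: le_trans split3 _.
rewrite -/f1 in b1; rewrite -/f2 in b2; rewrite card_SL2_rat in b3.
have q1 := q_gt1; have N0 := sqnorm_ge0 t f; have N1 := sqnorm_ge0 t f1.
have q12 : q + 1 <= 2 * q by lra.
have q0 : 0 <= q by lra.
set a := #|A|%:R in A0 b1 b2 b3 *.
have aq0 : 0 <= a * q by rewrite mulr_ge0.
have e1 : 2 * a * q * (q + 1) * sqnorm t f <= 4 * a * q ^+ 2 * sqnorm t f.
  rewrite ler_wpM2r //; nra.
have e2 : 2 * a * q * (q + 1) * sqnorm t f1 <= 4 * a * q ^+ 2 * sqnorm t f.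
  apply: le_trans e1; rewrite ler_wpM2l //; nra.
have e3 : q * (q - 1) * (q + 1) * a * sqnorm t f2 <= a * q ^+ 2 * sqnorm t f.
  have : q * sqnorm t f2 <= sqnorm t f by lra.
  have N2 := sqnorm_ge0 t f2.
  have a2 : 0 <= a * q ^+ 2 by nra.
  move/(ler_wpM2l a2); apply: le_trans.
  rewrite -subr_ge0 (_ : _ - _ = a * q * sqnorm t f2); last by ring.
  by rewrite !mulr_ge0.
by lra.
Qed.

End MeanZero.

(** * Sums of an element of SL_2 and a matrix *)

Section Sumset.
Variable F : finFieldType.
Variables B D : {set 'M[F]_2}.
Hypothesis BS : B \subset SL2 F.
Hypothesis cardD : #|D| = (#|F| ^ 2)%N.

Let q : rat := #|F|%:R.

Let q_gt1 : 1 < q. Proof. by rewrite ltr1n card_finNzRing_gt1. Qed.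

Let card_D_rat : #|D|%:R = q ^+ 2. Proof. by rewrite cardD natrX. Qed.

(** [E] varies because the count for [B] is later dominated by the count for all of [SL2 F]. *)
Definition sum_rep (E : {set 'M[F]_2}) (x : 'M[F]_2) : rat := \sum_(d in D) (x - d \in E)%:R.

Lemma sum_sum_rep (f : 'M[F]_2 -> rat) E :
  \sum_x f x * sum_rep E x = \sum_(b in E) \sum_(d in D) f (b + d).
Proof.
rewrite [RHS]exchange_big /=; under eq_bigr do rewrite mulr_sumr.
rewrite exchange_big /=; apply: eq_bigr => d _.
rewrite (reindex_inj (addIr d)) [RHS]big_mkcond /=; apply: eq_bigr => x _.
by rewrite addrK; case: (x \in E); rewrite ?mulr1 ?mulr0.
Qed.

Lemma sum_rep_total E : \sum_x sum_rep E x = #|E|%:R * q ^+ 2.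
Proof.
have := sum_sum_rep (fun=> 1) E; under eq_bigr do rewrite mul1r.
move=> ->; under eq_bigr do rewrite sumr_const card_D_rat.
by rewrite sumr_const mulr_natl.
Qed.

(** As [#|D| = q ^+ 2], the diagonal contributes at most [q ^+ 5] and the other pairs at most
    [q ^+ 6 + 2 * q ^+ 5]. Both second moments below have this shape. *)
Lemma sum_pairs_le (c : 'M[F]_2 -> 'M[F]_2 -> rat) :
  (forall d, c d d <= #|SL2 F|%:R) ->
  (forall d d', d != d' -> c d d' <= q ^+ 2 + 2 * q) ->
  \sum_(d in D) \sum_(d' in D) c d d' <= q ^+ 6 + 3 * q ^+ 5.
Proof.
move=> diag off.
have c_le d d' : c d d' <= (q ^+ 2 + 2 * q) + (if d' == d then #|SL2 F|%:R else 0).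
  case: eqVneq => [->|dd]; last by rewrite addr0 off // eq_sym.
  by apply: le_trans (diag d) _; rewrite lerDr; have := q_gt1; nra.
apply: le_trans (_ : \sum_(d in D) (q ^+ 2 * (q ^+ 2 + 2 * q) + #|SL2 F|%:R) <= _).
  apply: ler_sum => d dD; apply: le_trans (ler_sum _ (fun d' _ => c_le d d')) _.
  rewrite big_split /= sumr_const -[X in X + _ <= _]mulr_natl card_D_rat lerD2l -big_mkcondr /=.
  rewrite (big_pred1 d) // => d' /=; case: eqP => [->|]; by rewrite ?dD ?andbF.
rewrite sumr_const -[X in X <= _]mulr_natl card_D_rat card_SL2_rat -/q -subr_ge0.
rewrite (_ : _ - _ = q ^+ 3); last by ring.
by rewrite exprn_ge0 // ltW // (lt_trans ltr01).
Qed.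

(** With [s = x - d], having both [s] and [s + (d - d')] in [SL2 F] is a hyperplane condition on
    [s]. *)
Lemma sum_sqr_sum_rep_SL2 : \sum_x sum_rep (SL2 F) x ^+ 2 <= q ^+ 6 + 3 * q ^+ 5.
Proof.
have -> : \sum_x sum_rep (SL2 F) x ^+ 2 = \sum_(d in D) \sum_(d' in D)
    #|[set x | (x - d \in SL2 F) && (x - d' \in SL2 F)]|%:R.
  under eq_bigr => x _ do rewrite expr2 /sum_rep mulr_suml.
  rewrite exchange_big /=; apply: eq_bigr => d _; under eq_bigr do rewrite mulr_sumr.
  rewrite exchange_big /=; apply: eq_bigr => d' _.
  rewrite -sum1dep_card natr_sum [RHS]big_mkcond /=; apply: eq_bigr => x _.
  by rewrite -natrM mulnb; case: (_ && _).
apply: sum_pairs_le => [d|d d' dd].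
  rewrite ler_nat -(card_imset (SL2 F) (addIr d)); apply/subset_leq_card/subsetP => x.
  by rewrite inE andbb => xd; apply/imsetP; exists (x - d); rewrite ?subrK.
have /card_SL2_slice-/(_ (- \det (d - d'))) : d - d' != 0 by rewrite subr_eq0.
rewrite -natrX -natrM -natrD ler_nat; apply: leq_trans.
rewrite -[leqRHS](card_imset _ (addIr d)); apply/subset_leq_card/subsetP => x.
rewrite inE => /andP[xd xd']; apply/imsetP; exists (x - d); last by rewrite subrK.
move: xd xd'; rewrite !inE => xd /eqP xd'; rewrite xd /det_pol addrA subrK.
by rewrite xd' (eqP xd) subrr sub0r eqxx.
Qed.

(* Since [sum_rep B <= sum_rep (SL2 F)], whose deviation from its mean is small in
   square mean, one factor of [sum_rep B ^+ 2] may be replaced by that mean. *)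
Lemma sum_sqr_sum_rep : q ^+ 2 <= #|B|%:R -> \sum_x sum_rep B x ^+ 2 <= 7 * q ^+ 3 * #|B|%:R.
Proof.
move=> Bq; set g := sum_rep (SL2 F); set f := sum_rep B.
have fg x : f x <= g x.
  apply: ler_sum => d _; rewrite ler_nat; case: (boolP (_ \in B)) => // /(subsetP BS) ->.
  by [].
have f0 x : 0 <= f x by apply: sumr_ge0 => d _.
(* The exact mean of [g] is [q - q^-1]; centring at [q] costs only a term of order [q ^+ 4]. *)
have var : \sum_x (g x - q) ^+ 2 <= 5 * q ^+ 5.
  have -> : \sum_x (g x - q) ^+ 2 = \sum_x g x ^+ 2 - 2 * q * \sum_x g x + q ^+ 6.
    rewrite mulr_sumr -sumrB.
    have -> : q ^+ 6 = \sum_(x : 'M[F]_2) q ^+ 2.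
      by rewrite sumr_const card_mx -[RHS]mulr_natl natrX -/q -exprD.
    by rewrite -big_split; apply: eq_bigr => x _ /=; ring.
  rewrite sum_rep_total card_SL2_rat -/q; have := sum_sqr_sum_rep_SL2; rewrite -/g.
  have q3 : 0 <= q ^+ 3 * (q - 1) by rewrite mulr_ge0 ?exprn_ge0 // ?subr_ge0 ltW // (lt_trans ltr01).
  have q4 : 0 <= q ^+ 4 * (q - 1) by rewrite mulr_ge0 ?exprn_ge0 // ?subr_ge0 ltW // (lt_trans ltr01).
  have -> : 2 * q * (q * (q - 1) * (q + 1) * q ^+ 2) = 2 * q ^+ 6 - 2 * q ^+ 4 by ring.
  lra.
(* From [0 <= f <= g] follows [f ^+ 2 <= 2 * f * g - f ^+ 2], and [(g - q - f) ^+ 2 >= 0] bounds the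
   latter. *)
have pt x : f x ^+ 2 <= 2 * q * f x + (g x - q) ^+ 2.
  have := fg x; have := f0 x; move: (f x) (g x) => a b a0 ab.
  have := sqr_ge0 (b - q - a); nra.
apply: le_trans (ler_sum _ (fun x _ => pt x)) _.
rewrite big_split /= -mulr_sumr sum_rep_total.
have q3 : 0 <= q ^+ 3 by rewrite exprn_ge0 // ltW // (lt_trans ltr01).
have := ler_wpM2l q3 Bq; nra.
Qed.

Definition det_rep t : rat := \sum_(x | \det x == t) sum_rep B x.

Lemma det_rep_pairs t : det_rep t = \sum_(b in B) \sum_(d in D) (\det (b + d) == t)%:R.
Proof.
rewrite -(sum_sum_rep (fun x => (\det x == t)%:R)) /det_rep big_mkcond /=.
by apply: eq_bigr => x _; case: eqP; rewrite ?mul1r ?mul0r.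
Qed.

Lemma sum_det_rep : \sum_t det_rep t = #|B|%:R * q ^+ 2.
Proof.
by rewrite -sum_rep_total [RHS](partition_big (fun x : 'M[F]_2 => \det x) predT).
Qed.

(* Cauchy-Schwarz over [b], after which [b] is allowed to range over all of [SL2 F]. *)
Lemma det_rep_variance : \sum_t (det_rep t - q * #|B|%:R) ^+ 2 <= 4 * q ^+ 5 * #|B|%:R.
Proof.
pose n b t : rat := \sum_(d in D) (\det (b + d) == t)%:R.
have sum_n b : \sum_t n b t = q ^+ 2.
  rewrite exchange_big /= -card_D_rat -sumr_const; apply: eq_bigr => d _.
  by rewrite (bigD1 (\det (b + d))) //= eqxx big1 ?addr0 // => t; rewrite eq_sym => /negPf ->.
have cs t : (det_rep t - q * #|B|%:R) ^+ 2 <= #|B|%:R * \sum_(b in B) (n b t - q) ^+ 2.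
  have -> : det_rep t - q * #|B|%:R = \sum_(b in B) 1 * (n b t - q).
    under eq_bigr do rewrite mul1r.
    by rewrite sumrB det_rep_pairs sumr_const mulr_natr.
  apply: le_trans (cauchy_schwarz_sum _ _ _) _ => [i|i|]; rewrite ?num_real //.
  by rewrite sumr_const expr1n.
apply: le_trans (ler_sum _ (fun t _ => cs t)) _.
rewrite -mulr_sumr mulrC ler_wpM2r ?ler0n // exchange_big /=.
apply: (@le_trans _ _ (\sum_(b in SL2 F) \sum_t (n b t - q) ^+ 2)).
  rewrite [leRHS](big_setID B) /= (setIidPr BS) lerDl.
  by apply: sumr_ge0 => b _; apply: sumr_ge0 => t _; rewrite sqr_ge0.
have -> : \sum_(b in SL2 F) \sum_t (n b t - q) ^+ 2
    = \sum_(b in SL2 F) \sum_t n b t ^+ 2 - #|SL2 F|%:R * q ^+ 3.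
  rewrite mulr_natl -sumr_const -sumrB; apply: eq_bigr => b _.
  have -> : q ^+ 3 = 2 * q * \sum_t n b t - \sum_(t : F) q ^+ 2.
    by rewrite sum_n sumr_const -[X in _ - X]mulr_natl -/q; ring.
  by rewrite mulr_sumr -!sumrB; apply: eq_bigr => t _; ring.
have -> : \sum_(b in SL2 F) \sum_t n b t ^+ 2 = \sum_(d in D) \sum_(d' in D)
    #|[set b in SL2 F | \det (b + d) == \det (b + d')]|%:R.
  under [RHS]eq_bigr => d _.
    under eq_bigr => d' _.
      rewrite -sum1dep_card natr_sum big_mkcondr /=; over.
    rewrite exchange_big /=; over.
  rewrite [RHS]exchange_big /=; apply: eq_bigr => b _.
  under eq_bigr do rewrite expr2 /n mulr_suml.
  rewrite exchange_big /=; apply: eq_bigr => d _.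
  under eq_bigr do rewrite mulr_sumr.
  rewrite exchange_big /=; apply: eq_bigr => d' _.
  rewrite (bigD1 (\det (b + d))) //= eqxx mul1r big1 ?addr0.
    by rewrite eq_sym; case: eqP.
  by move=> t; rewrite eq_sym => /negPf ->; rewrite mul0r.
(* The coincidence [\det (b + d) = \det (b + d')] reads [det_pol b (d - d') = \det d' - \det d], a
   hyperplane section. *)
have bound : \sum_(d in D) \sum_(d' in D)
    #|[set b in SL2 F | \det (b + d) == \det (b + d')]|%:R <= q ^+ 6 + 3 * q ^+ 5.
  apply: sum_pairs_le => [d|d d' dd].
    by rewrite ler_nat; apply/subset_leq_card/subsetP => b; rewrite inE => /andP[].
  have /card_SL2_slice-/(_ (\det d' - \det d)) : d - d' != 0 by rewrite subr_eq0.
  rewrite -natrX -natrM -natrD ler_nat; apply: leq_trans.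
  apply/subset_leq_card/subsetP => b; rewrite !inE => /andP[-> /eqP E] /=.
  by rewrite det_pol_subr /det_pol E; apply/eqP; ring.
rewrite card_SL2_rat -/q; have -> : q * (q - 1) * (q + 1) * q ^+ 3 = q ^+ 6 - q ^+ 4 by ring.
have q4 : 0 <= q ^+ 4 * (q - 1) by rewrite mulr_ge0 ?exprn_ge0 // ?subr_ge0 ltW // (lt_trans ltr01).
lra.
Qed.

End Sumset.

(** * The energy estimate *)

Section Expansion.
Variable F : finFieldType.
Variables A B D : {set 'M[F]_2}.
Hypothesis AS : A \subset SL2 F.
Hypothesis BS : B \subset SL2 F.
Hypothesis cardD : #|D| = (#|F| ^ 2)%N.

Let q : rat := #|F|%:R.
Hypothesis card_B : (#|F| ^ 2 * 64 <= #|B|)%N.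

Let rep := sum_rep D B.

Let q_gt1 : 1 < q. Proof. by rewrite ltr1n card_finNzRing_gt1. Qed.

Let q_gt0 : 0 < q. Proof. exact: lt_trans ltr01 q_gt1. Qed.

Lemma card_B_rat : q ^+ 2 * 64 <= #|B|%:R.
Proof. by rewrite -natrX -natrM ler_nat. Qed.

(** [B] lies in [SL2 F], which has fewer than [q ^+ 3] elements, so small fields are excluded. *)
Lemma card_F_ge64 : 64 <= q.
Proof.
have : (#|B|%:R : rat) <= #|SL2 F|%:R by rewrite ler_nat subset_leq_card.
rewrite card_SL2_rat -/q => /(le_trans card_B_rat) H.
have q2 : 0 < q ^+ 2 := exprn_gt0 2 q_gt0.
rewrite -(ler_pM2l q2); apply: le_trans H _.
rewrite -subr_ge0 (_ : _ - _ = q); last by ring.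
exact: ltW.
Qed.

Lemma card_B_ge_sqr : q ^+ 2 <= #|B|%:R.
Proof.
rewrite -natrX ler_nat; apply: leq_trans card_B; exact: leq_pmulr.
Qed.

(** Write [rep] as its mean [m] on the coset plus [f]. Convolution sends [m] to [#|A| * m], the
    operator bound handles [f], and [(x + y) ^+ 2 <= 2 * x ^+ 2 + 2 * y ^+ 2] gives the 2 and
    [54 = 2 * 27]. *)
Lemma sqnorm_translate_sum_rep t : t != 0 ->
  sqnorm t (translate_sum A rep)
    <= 2 * #|A|%:R ^+ 2 / #|SL2 F|%:R * det_rep B D t ^+ 2
       + 54 * q ^+ 2 * #|A|%:R * sqnorm t rep.
Proof.
move=> t0; set N : rat := #|SL2 F|%:R; set a : rat := #|A|%:R.
have N0 : 0 < N by rewrite /N card_SL2_rat -/q; have := q_gt1; nra.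
pose m := det_rep B D t / N; pose f x := rep x - m.
have sum_const (k : rat) : \sum_(x : 'M[F]_2 | \det x == t) k = N * k.
  by rewrite -[N](sum_det_const _ t0) mulr_suml; under [RHS]eq_bigr do rewrite mul1r.
have f0 : \sum_(x | \det x == t) f x = 0.
  rewrite sumrB sum_const [N * m]mulrC /m divfK; [exact: subrr | exact: lt0r_neq0].
have := sqnorm_translate_sum_mean_zero AS t0 f0; rewrite -/q -/a.
have -> : sqnorm t f = sqnorm t rep - det_rep B D t ^+ 2 / N.
  have -> : det_rep B D t ^+ 2 / N = 2 * m * det_rep B D t - N * m ^+ 2.
    by rewrite /m; field; rewrite lt0r_neq0.
  rewrite -sum_const /det_rep mulr_sumr -!sumrB.
  by apply: eq_bigr => x _; rewrite /f -/(rep x); ring.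
have : sqnorm t (translate_sum A rep)
    <= 2 * sqnorm t (translate_sum A f) + N * (2 * (a * m) ^+ 2).
  rewrite -sum_const mulr_sumr -big_split; apply: ler_sum => y _ /=.
  have -> : translate_sum A rep y = translate_sum A f y + a * m.
    rewrite mulr_natl -sumr_const -big_split; apply: eq_bigr => b _.
    by rewrite /f /= subrK.
  have := sqr_ge0 (translate_sum A f y - a * m); nra.
have -> : N * (2 * (a * m) ^+ 2) = 2 * a ^+ 2 / N * det_rep B D t ^+ 2.
  by rewrite /m; field; rewrite lt0r_neq0.
have k0 : 0 <= 27 * q ^+ 2 * a * (det_rep B D t ^+ 2 / N).
  by apply: mulr_ge0; [rewrite !mulr_ge0 // ler0n | rewrite divr_ge0 ?sqr_ge0 // ltW].
move: (sqnorm t (translate_sum A rep)) (sqnorm t (translate_sum A f)) => X Z.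
rewrite mulrBr; lra.
Qed.

(** The mean contributes [q ^+ 3 * #|B| ^+ 2], and [q ^+ 2 <= #|B|] bounds the variance by four
    times that. *)
Lemma sum_sqr_det_rep : \sum_t det_rep B D t ^+ 2 <= 5 * q ^+ 3 * #|B|%:R ^+ 2.
Proof.
set b : rat := #|B|%:R.
have -> : \sum_t det_rep B D t ^+ 2 = \sum_t (det_rep B D t - q * b) ^+ 2
    + 2 * (q * b) * \sum_t det_rep B D t - \sum_(t : F) (q * b) ^+ 2.
  by rewrite mulr_sumr -big_split -sumrB; apply: eq_bigr => t _ /=; ring.
rewrite (sum_det_rep _ cardD) sumr_const -[X in _ - X]mulr_natl -/q -/b.
have := det_rep_variance BS cardD; rewrite -/q -/b.
have q3 : 0 <= q ^+ 3 * b by rewrite mulr_ge0 ?exprn_ge0 ?(ltW q_gt0) ?ler0n.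
have bq : q ^+ 2 <= b := card_B_ge_sqr.
have := ler_wpM2l q3 bq; move: (\sum_t _) => V; nra.
Qed.

(** Summing over [t != 0] with [2 / #|SL2 F| <= 4 / q ^+ 3] gives [20 = 4 * 5] and
    [378 = 54 * 7]. *)
Lemma energy_rep_le : \sum_(y | \det y != 0) translate_sum A rep y ^+ 2
  <= 20 * #|A|%:R ^+ 2 * #|B|%:R ^+ 2 + 378 * q ^+ 5 * #|A|%:R * #|B|%:R.
Proof.
set a : rat := #|A|%:R; set b : rat := #|B|%:R.
have a0 : 0 <= a by []; have b0 : 0 <= b by [].
have q0 := q_gt0.
rewrite [leLHS](partition_big (fun y : 'M[F]_2 => \det y) (fun t => t != 0)) /=; last by [].
apply: (@le_trans _ _ (\sum_(t | t != 0) (2 * a ^+ 2 / #|SL2 F|%:R * det_rep B D t ^+ 2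
       + 54 * q ^+ 2 * a * sqnorm t rep))).
  apply: ler_sum => t t0; apply: le_trans (sqnorm_translate_sum_rep t0).
  rewrite le_eqVlt; apply/orP; left; apply/eqP; apply: eq_bigl => y.
  by rewrite andbC; case: eqP => // ->; rewrite t0.
rewrite big_split -!mulr_sumr /=.
have nu : \sum_(t | t != 0) det_rep B D t ^+ 2 <= 5 * q ^+ 3 * b ^+ 2.
  apply: le_trans sum_sqr_det_rep; rewrite [leRHS](bigD1 0) //= lerDr; exact: sqr_ge0.
have rp : \sum_(t | t != 0) sqnorm t rep <= 7 * q ^+ 3 * b.
  apply: le_trans (sum_sqr_sum_rep BS cardD card_B_ge_sqr).
  rewrite [leRHS](partition_big (fun x : 'M[F]_2 => \det x) predT) //=.
  by rewrite [leRHS](bigD1 0) //= lerDr; exact: sqnorm_ge0.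
apply: lerD.
  have N2 : 2 * a ^+ 2 / #|SL2 F|%:R <= 4 * a ^+ 2 / q ^+ 3.
    have -> : 4 * a ^+ 2 / q ^+ 3 = 2 * a ^+ 2 * (2 / q ^+ 3) by field; rewrite lt0r_neq0.
    rewrite ler_wpM2l ?mulr_ge0 ?sqr_ge0 //.
    rewrite -[2 / _]invf_div lef_pV2 ?posrE ?divr_gt0 ?exprn_gt0 //.
      by rewrite card_SL2_rat -/q; have := card_F_ge64; move: q => r; nra.
    by rewrite card_SL2_rat -/q; have := card_F_ge64; move: q => r; nra.
  apply: le_trans (_ : 4 * a ^+ 2 / q ^+ 3 * (5 * q ^+ 3 * b ^+ 2) <= _).
    by apply: ler_pM; rewrite ?sumr_ge0 ?mulr_ge0 ?invr_ge0 ?ler0n ?sqr_ge0 // => *; exact: sqr_ge0.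
  by rewrite le_eqVlt; apply/orP; left; apply/eqP; field; rewrite lt0r_neq0.
have k0 : 0 <= 54 * q ^+ 2 * a.
  by apply: mulr_ge0 a0; apply: mulr_ge0 (sqr_ge0 _); exact: ler0n.
apply: le_trans (ler_wpM2l k0 rp) _.
by rewrite le_eqVlt; apply/orP; left; apply/eqP; ring.
Qed.

(** If most sums were singular, [det_rep B D 0] would exceed [q * #|B|] by at least
    [q ^+ 2 * #|B| / 4]; its square beats the variance bound once [#|B| > 64 * q]. *)
Lemma det_rep0_le : 2 * det_rep B D 0 <= #|B|%:R * q ^+ 2.
Proof.
rewrite leNgt; apply/negP => big.
have := det_rep_variance BS cardD; rewrite -/q; set b : rat := #|B|%:R in big *.
have q0 := q_gt0.
have b0 : 0 < b by apply: lt_le_trans card_B_ge_sqr; rewrite ?mulr_gt0 ?exprn_gt0.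
rewrite (bigD1 0) //=; set rest := \sum_(t | _) _.
have rest0 : 0 <= rest by apply: sumr_ge0 => t _; rewrite sqr_ge0.
have dev : q ^+ 2 * b / 4 <= det_rep B D 0 - q * b.
  have : 64 * (q * b) <= q * (q * b).
    exact: ler_wpM2r (ltW (mulr_gt0 q0 b0)) _ _ card_F_ge64.
  have := mulr_gt0 q0 b0; move: (det_rep B D 0) big => z; lra.
have dev0 : 0 <= q ^+ 2 * b / 4 by rewrite !mulr_ge0 ?exprn_ge0 // ltW.
have : (q ^+ 2 * b / 4) ^+ 2 <= (det_rep B D 0 - q * b) ^+ 2.
  by rewrite lerXn2r ?nnegrE // (le_trans dev0).
have q4b : 0 < q ^+ 4 * b by rewrite mulr_gt0 ?exprn_gt0.
have : (64 * q) * (q ^+ 4 * b) < b * (q ^+ 4 * b).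
  rewrite (ltr_pM2r q4b); apply: lt_le_trans card_B_rat.
  have -> : q ^+ 2 * 64 = 64 * q * q by ring.
  have p : 0 < 64 * q by apply: mulr_gt0 q0; rewrite ltr0n.
  by rewrite (ltr_pMr _ p); exact: q_gt1.
have -> : (q ^+ 2 * b / 4) ^+ 2 = b * (q ^+ 4 * b) / 16 by field.
have -> : 64 * q * (q ^+ 4 * b) = 16 * (4 * q ^+ 5 * b) by ring.
move: (b * _) ((_ - _) ^+ 2) (4 * _ * b) => X Z W; lra.
Qed.

Lemma sum_translate_sum_rep : \sum_(y | \det y != 0) translate_sum A rep y
  = #|A|%:R * (#|B|%:R * q ^+ 2 - det_rep B D 0).
Proof.
rewrite exchange_big mulr_natl -sumr_const; apply: eq_bigr => a aA /=.
have a1 : \det a = 1 by move/subsetP: AS => /(_ _ aA); rewrite inE => /eqP.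
have aU := det1_unitmx a1.
rewrite -(sum_rep_total cardD B) [X in _ = X - _](bigID (fun x : 'M[F]_2 => \det x == 0)) /=.
rewrite -/(det_rep B D 0) addrAC subrr add0r.
rewrite (reindex (mulmx a)) /=; last first.
  by exists (mulmx (invmx a)) => x _; rewrite ?mulKmx ?mulKVmx.
by apply: eq_big => x; rewrite ?mulKmx // det_mulmx a1 mul1r.
Qed.

Lemma translate_sum_rep_notin y : y \notin mul_add_set A B D -> translate_sum A rep y = 0.
Proof.
move=> yY; apply: big1 => a aA; apply: big1 => d dD.
case: (boolP (_ \in B)) => // bB; case/negP: yY.
have aU : a \in unitmx.
  by apply: det1_unitmx; move/subsetP: AS => /(_ _ aA); rewrite inE => /eqP.
apply/imsetP; exists (a, invmx a *m y - d, d) => /=; first by rewrite !inE aA bB dD.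
by rewrite subrK mulKVmx.
Qed.

(** Cauchy-Schwarz between the indicator of the product set and [translate_sum A rep] on invertible
    matrices, where at least half of the total mass lies. *)
Lemma card_mul_add_set_bound :
  #|A|%:R * #|B|%:R * q ^+ 4
    <= 4 * #|mul_add_set A B D|%:R * (20 * #|A|%:R * #|B|%:R + 378 * q ^+ 5).
Proof.
set Y := mul_add_set A B D; set a : rat := #|A|%:R; set b : rat := #|B|%:R.
have q0 := q_gt0.
have b0 : 0 < b by apply: lt_le_trans card_B_ge_sqr; rewrite ?mulr_gt0 ?exprn_gt0.
(* Empty [A] is treated apart, since a factor [a * b / 4] is cancelled at the end. *)
have [A0|A0] := posnP #|A|.
  rewrite /a A0 !(mulr0n, mul0r, mulr0, add0r); apply: mulr_ge0; apply: mulr_ge0.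
  - exact: ler0n.
  - exact: ler0n.
  - exact: ler0n.
  - exact: exprn_ge0 (ltW q0).
have a0 : 0 < a by rewrite ltr0n.
have := @cauchy_schwarz_sum rat _ (fun y : 'M[F]_2 => \det y != 0)
   (fun y => (y \in Y)%:R) (translate_sum A rep) (fun=> num_real _) (fun=> num_real _).
have -> : \sum_(y | \det y != 0) (y \in Y)%:R * translate_sum A rep y
    = \sum_(y | \det y != 0) translate_sum A rep y.
  apply: eq_bigr => y _; case: (boolP (y \in Y)) => yY; rewrite ?mul1r //.
  by rewrite translate_sum_rep_notin ?mulr0.
rewrite sum_translate_sum_rep -/a -/b => CS.
have YN : \sum_(y : 'M[F]_2 | \det y != 0) ((y \in Y)%:R : rat) ^+ 2 <= #|Y|%:R.
  rewrite -sum1_card natr_sum [leRHS]big_mkcond [leLHS]big_mkcond /=.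
  by apply: ler_sum => y _; case: (_ != 0); case: (y \in Y); rewrite ?expr1n ?expr0n.
have half : (a * (b * q ^+ 2 / 2)) ^+ 2 <= (a * (b * q ^+ 2 - det_rep B D 0)) ^+ 2.
  have h := det_rep0_le; rewrite -/b in h.
  have p : 0 <= b * q ^+ 2 / 2 by rewrite !mulr_ge0 ?exprn_ge0 // ltW.
  have p' : b * q ^+ 2 / 2 <= b * q ^+ 2 - det_rep B D 0 by lra.
  rewrite lerXn2r ?nnegrE ?ler_wpM2l ?mulr_ge0 ?(ltW a0) //.
  exact: le_trans p'.
have E := energy_rep_le; rewrite -/a -/b in E.
have {}CS : (a * (b * q ^+ 2 / 2)) ^+ 2
    <= #|Y|%:R * (20 * a ^+ 2 * b ^+ 2 + 378 * q ^+ 5 * a * b).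
  have N0 (P : pred 'M[F]_2) (f : 'M[F]_2 -> rat) : 0 <= \sum_(y | P y) f y ^+ 2.
    by apply: sumr_ge0 => y _; exact: sqr_ge0.
  exact: le_trans half (le_trans CS (ler_pM (N0 _ _) (N0 _ _) YN E)).
have ab4 : 0 < a * b / 4 by rewrite !mulr_gt0.
rewrite -(ler_pM2l ab4); move: CS.
have -> : (a * (b * q ^+ 2 / 2)) ^+ 2 = a * b / 4 * (a * b * q ^+ 4) by field.
move/le_trans; apply; rewrite le_eqVlt; apply/orP; left; apply/eqP; by field.
Qed.

End Expansion.

(** * Reduction to [#|D| = q ^+ 2] and choice of constants *)

Lemma exists_subset_card (T : finType) (D : {set T}) n : (n <= #|D|)%N ->
  exists2 E : {set T}, E \subset D & #|E| = n.
Proof.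
move=> nD; exists [set x in take n (enum D)].
  by apply/subsetP => x; rewrite inE => /mem_take; rewrite mem_enum.
by rewrite cardsE (card_uniqP _) ?take_uniq ?enum_uniq // size_takel // -cardE.
Qed.

Theorem theorem1p9 (R : realType) :
  exists C c : R, [/\ 0 < C, 0 < c &
    forall (F : finFieldType) (A B D : {set 'M[F]_2}),
      let q : R := #|F|%:R in
      A \subset SL2 F -> B \subset SL2 F ->
      C * q ^+ 2 <= #|B|%:R -> C * q ^+ 2 <= #|D|%:R ->
      c * Num.min (q ^+ 4)
            (Num.min (#|A|%:R * #|B|%:R ^+ 2 * #|D|%:R / q ^+ 5)
                     (#|A|%:R * #|B|%:R / q))
        <= #|mul_add_set A B D|%:R].
Proof.
(* The energy bound yields [a * b * q ^+ 4 <= 80 * y * (a * b) + 1512 * y * q ^+ 5], and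
   [80 + 1512 <= 2000]. *)
exists 64, (1 / 2000); split; [by [] | by rewrite divr_gt0 |].
move=> F A B D q AS BS hB hD.
have q0 : 0 < q by rewrite ltr0n (ltn_trans _ (card_finNzRing_gt1 F)).
have {}hB : (#|F| ^ 2 * 64 <= #|B|)%N by rewrite mulnC -(ler_nat R) natrM natrX.
have {}hD : (64 * #|F| ^ 2 <= #|D|)%N by rewrite -(ler_nat R) natrM natrX.
have [E ED cardE] : exists2 E : {set 'M[F]_2}, E \subset D & #|E| = (#|F| ^ 2)%N.
  by apply: exists_subset_card; apply: leq_trans hD; rewrite leq_pmull.
have castl (K : numDomainType) : (#|A| * #|B| * #|F| ^ 4)%N%:R
    = #|A|%:R * #|B|%:R * #|F|%:R ^+ 4 :> K by rewrite 2!natrM natrX.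
have castr (K : numDomainType) y : (4 * y * (20 * #|A| * #|B| + 378 * #|F| ^ 5))%N%:R
    = 4 * y%:R * (20 * #|A|%:R * #|B|%:R + 378 * #|F|%:R ^+ 5) :> K.
  by rewrite 2!natrM natrD 3!natrM natrX.
(* Stated between natural numbers, the bound passes from [rat] to [R]. *)
have bound : (#|A| * #|B| * #|F| ^ 4
    <= 4 * #|mul_add_set A B E| * (20 * #|A| * #|B| + 378 * #|F| ^ 5))%N.
  rewrite -(ler_nat rat) castl castr.
  exact: (card_mul_add_set_bound AS BS cardE hB).
have YE : (#|mul_add_set A B E| <= #|mul_add_set A B D|)%N.
  by apply/subset_leq_card/imsetS/setXS.
have {bound YE} : (#|A| * #|B| * #|F| ^ 4
    <= 4 * #|mul_add_set A B D| * (20 * #|A| * #|B| + 378 * #|F| ^ 5))%N.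
  by apply: leq_trans bound _; rewrite leq_mul2r leq_mul2l YE !orbT.
rewrite -(ler_nat R) castl castr -/q.
set a : R := #|A|%:R; set b : R := #|B|%:R; set y : R := #|mul_add_set A B D|%:R => bound.
have y0 : 0 <= y by []; have ab0 : 0 <= a * b by rewrite mulr_ge0.
have q5 : 0 < q ^+ 5 by rewrite exprn_gt0.
have c0 : 0 <= 1 / 2000 :> R by rewrite divr_ge0 ?ler0n.
apply: (@le_trans _ _ (1 / 2000 * Num.min (q ^+ 4) (a * b / q))).
  by apply: (ler_wpM2l c0); rewrite le_min !ge_min !lexx !orbT.
(* The larger of [a * b] and [q ^+ 5] dominates the right side of [bound], and cancelling it leaves
   [a * b / q] or [q ^+ 4] respectively. *)
have [small|large] := leP (a * b) (q ^+ 5).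
  have : 1 / 2000 * Num.min (q ^+ 4) (a * b / q) <= 1 / 2000 * (a * b / q).
    by apply: (ler_wpM2l c0); rewrite ge_min lexx orbT.
  move/le_trans; apply; rewrite -(ler_pM2r q5).
  have -> : 1 / 2000 * (a * b / q) * q ^+ 5 = a * b * q ^+ 4 / 2000.
    by field; rewrite lt0r_neq0.
  have : y * (a * b) <= y * q ^+ 5 by rewrite ler_wpM2l.
  have : 0 <= y * q ^+ 5 by rewrite mulr_ge0 // ltW.
  move: bound; rewrite (_ : 4 * y * _ = 80 * (y * (a * b)) + 1512 * (y * q ^+ 5)); last by ring.
  move: (a * b * q ^+ 4) (y * (a * b)) (y * q ^+ 5) => X Z W; lra.
have : 1 / 2000 * Num.min (q ^+ 4) (a * b / q) <= 1 / 2000 * q ^+ 4.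
  by apply: (ler_wpM2l c0); rewrite ge_min lexx.
move/le_trans; apply; rewrite -(ler_pM2r (lt_trans q5 large)).
have : y * q ^+ 5 <= y * (a * b) by rewrite ler_wpM2l // ltW.
have : 0 <= y * (a * b) by rewrite mulr_ge0.
move: bound; rewrite (_ : 4 * y * _ = 80 * (y * (a * b)) + 1512 * (y * q ^+ 5)); last by ring.
rewrite (_ : 1 / 2000 * q ^+ 4 * (a * b) = a * b * q ^+ 4 / 2000); last by ring.
move: (a * b * q ^+ 4) (y * (a * b)) (y * q ^+ 5) => X Z W; lra.
Qed.
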